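(* When collecting samples online using an abstraction function, such samples are not necessarily independent. That is, there exist a finite MDP $M$, a state abstraction function $\phi:S\to\bar S$, a start state, a policy, an abstract state-action pair $(\bar s,a)$, an integer $m\ge 2$, and abstract states $\bar s'_1,\dots,\bar s'_m\in\bar S$ such that the first $m$ samples $\bar Y^{(1)}_{\bar s,a},\dots,\bar Y^{(m)}_{\bar s,a}$ collected online for $(\bar s,a)$ satisfy $$\Pr\big(\bar Y^{(1)}_{\bar s,a}=\bar s'_1,\dots,\bar Y^{(m)}_{\bar s,a}=\bar s'_m\big)\neq\Pr\big(\bar Y^{(1)}_{\bar s,a}=\bar s'_1\big)\cdots\Pr\big(\bar Y^{(m)}_{\bar s,a}=\bar s'_m\big).$$
   Context: An MDP has finite state set $S$, finite action set $A$ and transition probabilities $T(s'|s,a)$. A state abstraction function is a surjection $\phi:S\to\bar S$. The agent acts in the MDP with a policy choosing actions on the basis of the observed abstract states $\phi(s_t)$, and the true states evolve by $s_{t+1}\sim T(\cdot|s_t,a_t)$. For an abstract state-action pair $(\bar s,a)$, let $\tau_1<\tau_2<\cdots$ be the successive time steps $t$ at which $\phi(s_t)=\bar s$ and $a_t=a$ (in the example these occur almost surely); the $i$-th sample is $\bar Y^{(i)}_{\bar s,a}=\phi(s_{\tau_i+1})$. *)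

(* Defs.v *)
From HB Require Import structures.
From mathcomp Require Import all_boot all_order all_algebra.
From mathcomp Require Import all_classical all_reals all_analysis.

Set Implicit Arguments.
Unset Strict Implicit.
Unset Printing Implicit Defensive.

Import Order.TTheory GRing.Theory Num.Theory.
Local Open Scope classical_set_scope.
Local Open Scope ring_scope.

Record fin_dist (R : realType) (T : finType) := FinDist {
  pmf :> T -> R;
  pmf_ge0 : forall x, 0 <= pmf x;
  pmf_sum1 : \sum_x pmf x = 1 }.

(* [trans M s a s'] is T(s'|s,a). *)
Record mdp (R : realType) (S A : finType) := MDP {
  trans : S -> A -> fin_dist R S }.

(* A randomized policy that sees only the current abstract state. *)
Definition abs_policy (R : realType) (Sbar A : finType) :=
  Sbar -> fin_dist R A.

(* The state-action process on some probability space. S and A carry the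
   discrete sigma-algebra, so measurability of the fibres is measurability of
   [st t] and [act t]. The finite-dimensional laws [run_law] say
     s_0 = s0,  a_t ~ pi(.|phi(s_t)),  s_(t+1) ~ T(.|s_t,a_t)
   where each draw depends on the past only through the displayed condition;
   they determine the joint law of the whole trajectory. *)
Record mdp_run (R : realType) (S Sbar A : finType) (M : mdp R S A)
    (phi : S -> Sbar) (s0 : S) (pi : abs_policy R Sbar A) := MDPRun {
  run_disp : measure_display;
  run_space : measurableType run_disp;
  run_prob : probability run_space R;
  st : nat -> run_space -> S;
  act : nat -> run_space -> A;
  measurable_st : forall t x, measurable [set w | st t w = x];
  measurable_act : forall t b, measurable [set w | act t w = b];
  run_law : forall (n : nat) (x : nat -> S) (b : nat -> A),
    run_prob [set w | forall t, (t <= n)%N -> st t w = x t /\ act t w = b t] =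
    ((x 0%N == s0)%:R * \prod_(t < n.+1) pi (phi (x t)) (b t)
       * \prod_(t < n) trans M (x t) (b t) (x t.+1))%:E }.

Section Sampling.
Context (R : realType) (S Sbar A : finType) (M : mdp R S A)
  (phi : S -> Sbar) (s0 : S) (pi : abs_policy R Sbar A)
  (X : mdp_run M phi s0 pi) (sbar : Sbar) (a : A).

Definition visit (t : nat) (w : run_space X) : bool :=
  (phi (st t w) == sbar) && (act t w == a).

(* First visit at time >= n; [None] if there is none. *)
Definition next_visit (n : nat) (w : run_space X) : option nat :=
  if pselect (exists t, (n <= t)%N && visit t w) is left ex
  then Some (ex_minn ex) else None.

(* Numbered from 0: [tau k] is the time of the (k+1)-st visit. *)
Fixpoint tau (k : nat) (w : run_space X) : option nat :=
  if k is k'.+1 then obind (fun t => next_visit t.+1 w) (tau k' w)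
  else next_visit 0 w.

(* [Ybar k] is the (k+1)-st sample, [None] if the (k+1)-st visit never
   happens. *)
Definition Ybar (k : nat) (w : run_space X) : option Sbar :=
  omap (fun t => phi (st t.+1 w)) (tau k w).

End Sampling.

(* Real-valued probability of an event of a run. *)
Definition Pr (R : realType) (S Sbar A : finType) (M : mdp R S A)
    (phi : S -> Sbar) (s0 : S) (pi : abs_policy R Sbar A)
    (X : mdp_run M phi s0 pi) (E : set (run_space X)) : R :=
  fine (run_prob X E).

Arguments tau {R S Sbar A M phi s0 pi} X sbar a k w.
Arguments Ybar {R S Sbar A M phi s0 pi} X sbar a k w.
Arguments Pr {R S Sbar A M phi s0 pi} X E.

(* Main.v *)
Require Import Defs.
From HB Require Import structures.
From mathcomp Require Import all_boot all_order all_algebra.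
From mathcomp Require Import all_classical all_reals all_analysis.
From mathcomp Require Import lra.
Import Order.TTheory GRing.Theory Num.Theory.
Local Open Scope classical_set_scope.
Local Open Scope ring_scope.

(* A fair coin [c], tossed at the first step, is stored in the true state but
   hidden by the abstraction. If [c] is heads, the observation is always
   [true]; if it is tails, the observation alternates. The samples for the
   abstract state [true] are then all equal to [c], so that the first two agree
   with probability 1/2 on [true], instead of 1/4. *)

(** * Indicator products and almost sure equality of events *)

Lemma prodr_nat_of_bool (R : realType) (n : nat) (P : pred nat) :
  \prod_(t < n) (P t)%:R = [forall t : 'I_n, P t]%:R :> R.
Proof.
have [/forallP h|/forallPn[t nPt]] := boolP [forall t : 'I_n, P t].
  by rewrite big1// => t _; rewrite h.
by rewrite (bigD1 t)//= (negbTE nPt) mul0r.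
Qed.

(** Both sides equal the measure of the intersection, since each difference is negligible. This
    later trades events on samples for an event whose law is known. *)
Lemma measure_ae_eq d (T : measurableType d) (R : realType)
    (mu : {measure set T -> \bar R}) (E F : set T) :
  measurable E -> measurable F -> {ae mu, forall w, E w <-> F w} ->
  mu E = mu F.
Proof.
have key (A B : set T) : measurable A -> measurable B ->
    {ae mu, forall w, A w <-> B w} -> mu A = mu (A `&` B).
  move=> mA mB AB; rewrite (measureDI mu mA mB).
  rewrite -[RHS]add0e; congr (_ + _)%E.
  apply: (negligibleP mu (measurableD mA mB)).1.
  by apply: negligibleS AB => w [Aw nBw] /= iAB; apply: nBw; apply/iAB.
move=> mE mF EF; rewrite (key E F)// setIC -(key F E)//.
by apply: filterS EF => w [? ?]; split.
Qed.

(** * Measurability of visit times and samples *)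

Section Sampling_measurability.
Context {R : realType} {S Sbar A : finType} {M : mdp R S A}
  {phi : S -> Sbar} {s0 : S} {pol : abs_policy R Sbar A}
  (X : mdp_run M phi s0 pol) (sbar : Sbar) (a : A).

Lemma measurable_st_pred (t : nat) (Q : set S) :
  measurable [set w : run_space X | Q (st t w)].
Proof.
rewrite (_ : [set _ | _] = \bigcup_(x in Q) [set w : run_space X | st t w = x]).
  apply: fin_bigcup_measurable => // x _; exact: measurable_st.
by apply/seteqP; split=> [w Qw|w [x Qx /= ->]//]; exists (st t w).
Qed.

Lemma measurable_visit (t : nat) :
  measurable [set w : run_space X | visit sbar a t w].
Proof.
rewrite (_ : [set _ | _] = [set w : run_space X | phi (st t w) = sbar] `&`
                           [set w | act t w = a]).
  apply: measurableI; last exact: measurable_act.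
  exact: (measurable_st_pred t [set x | phi x = sbar]).
apply/seteqP; rewrite /visit; split=> w /=.
  by move=> /andP[/eqP-> /eqP->].
by move=> [-> ->]; rewrite !eqxx.
Qed.

(** Unfolding the minimum leaves conditions on finitely many times, which serve both for
    measurability and for checking explicit visit times. *)
Lemma next_visitP (n t : nat) (w : run_space X) :
  next_visit sbar a n w = Some t <->
  [/\ (n <= t)%N, visit sbar a t w &
      forall u, (n <= u < t)%N -> ~~ visit sbar a u w].
Proof.
rewrite /next_visit; split.
  case: pselect => // ex [<-]; case: ex_minnP => m /andP[nm vm] min.
  split=> // u /andP[nu um]; apply/negP => vu.
  by have := min u; rewrite nu vu => /(_ isT); rewrite leqNgt um.
move=> [nt vt noVisit]; case: pselect => [ex|[]]; last by exists t; rewrite nt.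
case: ex_minnP => m /andP[nm vm] min; congr Some; apply/eqP.
rewrite eqn_leq min ?nt//=; rewrite leqNgt; apply/negP => mt.
by have := noVisit m; rewrite nm mt vm => /(_ isT).
Qed.

Lemma measurable_next_visit (n t : nat) :
  measurable [set w : run_space X | next_visit sbar a n w = Some t].
Proof.
rewrite (_ : [set _ | _] = [set w : run_space X | (n <= t)%N] `&`
  ([set w | visit sbar a t w] `&` \bigcap_(u in [set u | n <= u < t]%N)
     ~` [set w | visit sbar a u w])).
  (* This set does not depend on [w], so it is the preimage under [st t] of a constant predicate. *)
  apply: measurableI; first exact: (measurable_st_pred t (fun=> (n <= t)%N)).
  apply: measurableI; first exact: measurable_visit.
  by apply: bigcap_measurableType => u _; apply: measurableC;
    exact: measurable_visit.
apply/seteqP; split=> w /=; rewrite next_visitP.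
  by move=> [? ? h]; do !split=> //; move=> u /h /negP.
by move=> [? [? h]]; split=> // u /h /negP.
Qed.

Lemma measurable_tau (k t : nat) :
  measurable [set w : run_space X | tau X sbar a k w = Some t].
Proof.
elim: k t => [|k IH] t /=; first exact: measurable_next_visit.
rewrite (_ : [set _ | _] = \bigcup_u
  ([set w : run_space X | tau X sbar a k w = Some u] `&`
   [set w | next_visit sbar a u.+1 w = Some t])).
  apply: bigcup_measurable => u _.
  by apply: measurableI; [exact: IH | exact: measurable_next_visit].
apply/seteqP; split=> w /=; last by move=> [u _ [/= -> ]].
by case E: tau => [u|] //= nv; exists u.
Qed.

Lemma measurable_Ybar (k : nat) (y : Sbar) :
  measurable [set w : run_space X | Ybar X sbar a k w = Some y].
Proof.
rewrite /Ybar (_ : [set _ | _] = \bigcup_u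
  ([set w : run_space X | tau X sbar a k w = Some u] `&`
   [set w | phi (st u.+1 w) = y])).
  apply: bigcup_measurable => u _; apply: measurableI.
    exact: measurable_tau.
  exact: (measurable_st_pred u.+1 [set x | phi x = y]).
apply/seteqP; split=> w /=; last by move=> [u _ [/= -> <-]].
by case E: tau => [u|] //= [nv]; exists u.
Qed.

End Sampling_measurability.

(** * The coin MDP, its trajectory weights and a concrete run *)

Section Coin_image.
Context {R : realType} {T : finType} (f : bool -> T).

(** The law of [f c] for a fair coin [c]. A constant [f] yields a point mass, so one construction
    covers the toss, the deterministic moves and the policy. *)
Definition coin_pmf (x : T) : R := (\sum_c (x == f c)%:R) / 2.

Lemma coin_pmf_ge0 x : 0 <= coin_pmf x.
Proof. by rewrite divr_ge0// sumr_ge0. Qed.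

Lemma coin_pmf_sum1 : \sum_x coin_pmf x = 1.
Proof.
rewrite -mulr_suml exchange_big big_bool/=.
have E y : \sum_x (x == y)%:R = 1 :> R.
  by rewrite (bigD1 y)//= eqxx big1 ?addr0// => x /negbTE->.
by rewrite !E; lra.
Qed.

Definition coin_image : fin_dist R T := FinDist coin_pmf_ge0 coin_pmf_sum1.

End Coin_image.

Definition state : finType := option (bool * bool).

(* [None] is the start state; [Some (c, p)] stores the coin and the
   observation. *)
Definition obs (s : state) : bool := if s is Some (_, p) then p else true.

(** Only the move out of [None] uses the toss [c]; every later move ignores it. *)
Definition step (s : state) (c : bool) : state :=
  if s is Some (c', p) then Some (c', c' || ~~ p) else Some (c, c).

Definition coin_mdp (R : realType) : mdp R state unit :=
  MDP (fun s _ => coin_image (step s)).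

Definition unit_policy (R : realType) : abs_policy R bool unit :=
  fun _ => coin_image (fun _ => tt).

Definition path_of (c : bool) (t : nat) : state :=
  if t is u.+1 then Some (c, c || odd u) else None.

Lemma obs_path (c : bool) (t : nat) : obs (path_of c t) = c || ~~ odd t.
Proof. by case: t => [|t] /=; rewrite ?orbT// negbK. Qed.

Lemma trans_path (R : realType) (c : bool) (t : nat) (s : state) :
  trans (coin_mdp R) (path_of c t.+1) tt s = (s == path_of c t.+2)%:R.
Proof.
rewrite /= /coin_pmf big_bool/= (_ : c || ~~ (c || odd t) = c || ~~ odd t);
  last by case: c.
by case: eqP => _ /=; lra.
Qed.

(* A trajectory is obtained by tossing the coin and then following the path,
   hence its weight is the average over the two paths. *)
Lemma path_weight (R : realType) (n : nat) (x : nat -> state)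
    (b : nat -> unit) :
  (x 0%N == None)%:R * \prod_(t < n.+1) unit_policy R (obs (x t)) (b t)
    * \prod_(t < n) trans (coin_mdp R) (x t) (b t) (x t.+1)
  = (\sum_c [forall t : 'I_n.+1, x t == path_of c t]%:R) / 2.
Proof.
rewrite [X in _ * X * _]big1; last first.
  by move=> t _; rewrite /= /coin_pmf big_bool /=; case: (b t); lra.
rewrite mulr1 (eq_bigr (fun c => \prod_(t < n.+1) (x t == path_of c t)%:R));
  last first.
  by move=> c _; rewrite (prodr_nat_of_bool _ _ (fun t => x t == path_of c t)).
case: n => [|n]; first by rewrite big_ord0 big_bool !big_ord1/=; lra.
(* The induction starts at one transition: the toss happens there, and [trans_path] covers only
   later moves. *)
elim: n => [|n IH].
  rewrite big_ord1 big_bool !big_ord_recr !big_ord0 /=.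
  by case: eqP => [->|_]; rewrite /= /coin_pmf ?big_bool /=; lra.
rewrite big_ord_recr/= mulrA IH mulrAC; congr (_ / 2).
rewrite mulr_suml; apply: eq_bigr => c _; rewrite [RHS]big_ord_recr /=.
rewrite big_ord_recr /= -!mulrA; congr (_ * _).
(* Off the path at time [n.+1], the indicator kills both sides; on it, the last transition is a
   point mass. *)
case: eqP => [->|_]; last by rewrite !mul0r.
by case: (b n.+1); rewrite -trans_path !mul1r.
Qed.

(** The trajectory is a function of the coin, so its law is the average of two Dirac masses, as in
    [path_weight]. *)
Lemma coin_run_law (R : realType) (n : nat) (x : nat -> state)
    (b : nat -> unit) :
  bernoulli_prob (2^-1 : R)
    [set c | forall t, (t <= n)%N -> path_of c t = x t /\ tt = b t] =
  ((x 0%N == None)%:R * \prod_(t < n.+1) unit_policy R (obs (x t)) (b t)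
    * \prod_(t < n) trans (coin_mdp R) (x t) (b t) (x t.+1))%:E.
Proof.
rewrite path_weight bernoulli_probE; last by apply/andP; split; lra.
set D := [set _ | _].
have DE c : \d_c D = ([forall t : 'I_n.+1, x t == path_of c t]%:R)%:E :> \bar R.
  rewrite diracE; congr ((nat_of_bool _)%:R%:E); apply/idP/idP.
    rewrite inE => Dc; apply/forallP => t.
    by have [->] := Dc t (ltn_ord t : (t < n.+1)%N).
  move=> /forallP h; rewrite inE => t tn; split; last by case: (b t).
  by have /eqP -> := h (Ordinal (tn : (t < n.+1)%N)).
rewrite !DE big_bool/= -!EFinM -EFinD; congr EFin; rewrite /unstable.onem.
set u := _%:R; set v := _%:R; lra.
Qed.

(** The sample space is the coin itself. This run keeps the claim about all runs from being
    vacuous. *)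
Definition coin_run (R : realType) :
  mdp_run (coin_mdp R) obs None (unit_policy R).
Proof.
apply: (@MDPRun _ _ _ _ _ _ _ _ _ bool (bernoulli_prob (2^-1 : R))
  (fun t c => path_of c t) (fun _ _ => tt)) => //.
exact: coin_run_law.
Defined.

(** * Samples in an arbitrary run of the coin MDP *)

Section Coin_samples.
Context {R : realType} (X : mdp_run (coin_mdp R) obs None (unit_policy R)).

Definition follows (c : bool) (n : nat) : set (run_space X) :=
  [set w | forall t, (t <= n)%N -> st t w = path_of c t].

Lemma measurable_follows c n : measurable (follows c n).
Proof.
rewrite (_ : follows c n = \bigcap_(t in [set t | (t <= n)%N])
   [set w : run_space X | st t w = path_of c t])//.
by apply: bigcap_measurableType => t _; exact: measurable_st.
Qed.

(** The horizon is positive because both paths start at [None]; they differ from time 1 on, so a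
    single term of the average survives. *)
Lemma follows_half c n : run_prob X (follows c n.+1) = (2^-1)%:E.
Proof.
have := run_law X n.+1 (path_of c) (fun=> tt).
rewrite (path_weight R n.+1 (path_of c) (fun=> tt)) => law.
rewrite (_ : follows c n.+1 = [set w : run_space X | forall t, (t <= n.+1)%N ->
  st t w = path_of c t /\ act t w = tt]); last first.
  apply/seteqP; split=> w h t /h; last by case.
  by move=> ->; case: (act t w).
have E c' : [forall t : 'I_n.+2, path_of c t == path_of c' t] = (c == c').
  apply/forallP/eqP => [/(_ 1%:R)/=|->//].
  by move=> /eqP[].
by rewrite law big_bool !E; case: c {law E} => /=; congr EFin; lra.
Qed.

(** At each positive horizon, two disjoint events of probability 1/2 exhaust the space up to a null
    set; countably many horizons are then combined. *)
Lemma ae_follows :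
  {ae run_prob X, forall w, exists c, forall t, st t w = path_of c t}.
Proof.
have key : {ae run_prob X, forall w, forall n,
    (follows true n.+1 `|` follows false n.+1) w}.
  apply: ae_foralln => n; set U := _ `|` _.
  have mU : measurable U by apply: measurableU; exact: measurable_follows.
  apply/(negligibleP _ (measurableC mU)).
  have disj : follows true n.+1 `&` follows false n.+1 = set0.
    by rewrite -subset0 => w [/(_ 1%N isT) e /(_ 1%N isT)]; rewrite e.
  apply: etrans (probability_setC (run_prob X) mU) _.
  rewrite measureU//; try exact: measurable_follows.
  transitivity ((1 - (2^-1 + 2^-1))%:E : \bar R); last by congr EFin; lra.
  by rewrite EFinB EFinD; congr (_ - (_ + _))%E; exact: follows_half.
(* Reading the coin off the state at time 1 makes all horizons choose the same path. *)
apply: filterS key => w h; exists (st 1 w == Some (true, true)) => t.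
by have [h'|h'] := h t; rewrite (h' 1%N)// (h' t)//.
Qed.

Lemma visit_path c t (w : run_space X) : st t w = path_of c t ->
  visit true tt t w = c || ~~ odd t.
Proof. by move=> h; rewrite /visit h obs_path eqb_id; case: (act t w); rewrite andbT. Qed.

(** With heads every time is a visit; with tails exactly the even times are. *)
Lemma tau_path c k (w : run_space X) : (forall t, st t w = path_of c t) ->
  tau X true tt k w = Some (if c then k else k.*2).
Proof.
move=> h; elim: k => [|k IH] /=.
  rewrite double0 if_same; apply/next_visitP; split=> //.
  by rewrite (visit_path c)// orbT.
rewrite IH /=; apply/next_visitP; split.
- by case: (c).
- by rewrite (visit_path c)//; case: c {h IH} => //=; rewrite odd_double.
- move=> u; rewrite (visit_path c)//; case: c {h IH} => /= /andP[ku uk].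
    by have := leq_trans uk ku; rewrite ltnn.
  (* The only time strictly between consecutive visits is odd. *)
  have -> : u = k.*2.+1 by apply/eqP; rewrite eqn_leq ku andbT -ltnS.
  by rewrite /= odd_double.
Qed.

(** With tails each sample is taken right after an even time, hence at an odd one, where the
    observation is [false]. *)
Lemma Ybar_path c k (w : run_space X) : (forall t, st t w = path_of c t) ->
  Ybar X true tt k w = Some c.
Proof.
move=> h; rewrite /Ybar (tau_path c)//= h obs_path; congr Some.
by case: c {h} => //=; rewrite odd_double.
Qed.

(** All samples equal the coin, so up to a null set each event is heads. Having all [k] under one
    null set also handles the joint event. *)
Lemma ae_Ybar :
  {ae run_prob X, forall w, forall k,
    Ybar X true tt k w = Some true <-> follows true 1 w}.
Proof.
apply: filterS ae_follows => w [c h] k; rewrite (Ybar_path c)//.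
split=> [[cT] t _|/(_ 1%N isT)]; first by rewrite h cT.
by rewrite h => -[->].
Qed.

Lemma Pr_half (E : set (run_space X)) : measurable E ->
  {ae run_prob X, forall w, E w <-> follows true 1 w} -> Pr X E = 2^-1.
Proof.
move=> mE aeE; rewrite /Pr; suff -> : run_prob X E = (2^-1)%:E by [].
apply: etrans (follows_half true 0).
by apply: measure_ae_eq aeE => //; exact: measurable_follows.
Qed.

End Coin_samples.

Theorem mainTheorem3 (R : realType) :
  exists (S Sbar A : finType) (M : mdp R S A) (phi : S -> Sbar) (s0 : S)
    (pi : abs_policy R Sbar A) (sbar : Sbar) (a : A)
    (m : nat) (y : 'I_m -> Sbar),
    [/\ set_surj [set: S] [set: Sbar] phi,
        (2 <= m)%N,
        inhabited (mdp_run M phi s0 pi) &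
        forall X : mdp_run M phi s0 pi,
          {ae run_prob X, forall w, forall k, tau X sbar a k w <> None} /\
          Pr X [set w | forall k : 'I_m, Ybar X sbar a k w = Some (y k)]
          <> \prod_(k < m) Pr X [set w | Ybar X sbar a k w = Some (y k)]].
Proof.
exists state, bool, unit, (coin_mdp R), obs, None, (unit_policy R), true, tt.
exists 2, (fun=> true); split=> //.
- by move=> b _; exists (Some (b, b)).
- exact: (inhabits (coin_run R)).
move=> X; split.
  by apply: filterS (ae_follows X) => w [c h] k; rewrite (tau_path X c).
have PrY (k : nat) : Pr X [set w | Ybar X true tt k w = Some true] = 2^-1.
  apply: Pr_half; first exact: measurable_Ybar.
  by apply: filterS (ae_Ybar X) => w /(_ k).
rewrite (eq_bigr (fun=> 2^-1)) => [|k _]; last exact: PrY.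
(* The joint event is almost surely heads too, so 1/2 is compared with the square of 1/2. *)
rewrite prodr_const card_ord Pr_half.
- by move=> eq_half; lra.
- rewrite (_ : [set _ | _] = \bigcap_(k in [set: 'I_2])
    [set w | Ybar X true tt k w = Some true]).
    by apply: fin_bigcap_measurable => // k _; exact: measurable_Ybar.
  by apply/seteqP; split=> w h k; [move=> _|]; exact: h.
- apply: filterS (ae_Ybar X) => w h; split=> [/(_ ord0)/h //|fw k].
  exact/h.
Qed.
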